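(* $V_4=\displaystyle\inf_{a\in[1.5597515,\,2\cos\frac{\pi}{6}]}\frac{\chi_4(a)}{(\sqrt a-1)^2}$.
   Context: For an integer $n\ge 2$, $C_n$ denotes the set of real cosine polynomials $f(\phi)=\sum_{k=0}^{n} a_k\cos(k\phi)$ such that (i) all coefficients are real and nonnegative, (ii) $a_1>a_0>0$, and (iii) $f(\phi)\ge 0$ for all real $\phi$. For $f\in C_n$, $v(f)=\dfrac{f(0)-a_0}{(\sqrt{a_1}-\sqrt{a_0})^2}$ and $V_n=\inf_{f\in C_n}v(f)$. For $a\in\left(1,2\cos\frac{\pi}{n+2}\right]$, $\chi_n(a)=\inf\{f(0)-1 : f\in C_n,\ a_0(f)=1,\ a_1(f)=a\}$, where $a_k(f)$ is the $k$-th cosine coefficient of $f$. Numerical constants are decimal values as given in the paper, to seven decimal places. *)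

(* Defs.v *)
From mathcomp Require Import all_boot all_order all_algebra.
From mathcomp Require Import all_classical all_reals all_analysis.

Set Implicit Arguments.
Unset Strict Implicit.
Unset Printing Implicit Defensive.

Import Order.TTheory GRing.Theory Num.Theory.

Local Open Scope classical_set_scope.
Local Open Scope ring_scope.

(* A cosine polynomial of order n is represented by its vector of cosine
   coefficients, which the polynomial determines uniquely. *)
Definition cospoly (R : realType) (n : nat) (a : 'I_n.+1 -> R) (phi : R) : R :=
  \sum_(k < n.+1) a k * cos (k%:R * phi).

(* For n >= 1, [inord 1] is the index 1 (it is 0 in the excluded case n = 0). *)
Definition coef0 (R : realType) (n : nat) (a : 'I_n.+1 -> R) : R := a ord0.
Definition coef1 (R : realType) (n : nat) (a : 'I_n.+1 -> R) : R := a (inord 1).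

(* The class C_n; used for n >= 2. *)
Definition Ccos (R : realType) (n : nat) : set ('I_n.+1 -> R) :=
  [set a | [/\ forall k, 0 <= a k,
               0 < coef0 a,
               coef0 a < coef1 a
             & forall phi : R, 0 <= cospoly a phi]].
Arguments Ccos : clear implicits.

Definition vfun (R : realType) (n : nat) (a : 'I_n.+1 -> R) : R :=
  (cospoly a 0 - coef0 a) / (Num.sqrt (coef1 a) - Num.sqrt (coef0 a)) ^+ 2.

(* Infima are taken in the extended reals, where the infimum of the empty set
   is +oo; the real-valued [inf] would give it the junk value 0. *)
Definition Vinf (R : realType) (n : nat) : \bar R :=
  ereal_inf [set (vfun a)%:E | a in Ccos R n].
Arguments Vinf : clear implicits.

Definition chi (R : realType) (n : nat) (t : R) : \bar R :=
  ereal_inf [set (cospoly a 0 - 1)%:E |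
             a in Ccos R n `&` [set a | coef0 a = 1 /\ coef1 a = t]].

(* Main.v *)
Require Import Defs.
From mathcomp Require Import all_boot all_order all_algebra.
From mathcomp Require Import all_classical all_reals all_analysis.
From mathcomp Require Import ring lra.

(** Rescaling [f] so that [a_0 = 1] turns [V_4] into the infimum over all
    admissible [a = a_1] of [chi_4(a) / (sqrt a - 1)^2], and
    [2 f(5 pi/6) + f(pi/2) >= 0] gives [a <= sqrt 3].  Only values
    [a < 1.5597515] have to be excluded.  With [cos phi = -4/5], subtracting
    [(125/44) f(phi) >= 0] from [f(0) - 1] leaves nonnegative coefficients at
    [a_2, a_3, a_4] and yields [f(0) - 1 >= (144 a - 125)/44], which exceeds [36 (sqrt a - 1)^2] for
    such [a]; whereas [(1 + cos phi)^2 (1 + 2 cos phi)^2 / 9], for which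
    [a = 5/3], has [v < 36]. *)

Set Implicit Arguments.
Unset Strict Implicit.
Unset Printing Implicit Defensive.

Import Order.TTheory GRing.Theory Num.Theory.

Local Open Scope classical_set_scope.
Local Open Scope ring_scope.

Lemma cos_mul3 (R : realType) (x : R) :
  cos (3 * x) = 4 * cos x ^+ 3 - 3 * cos x.
Proof.
have -> : 3 * x = x *+ 2 + x by ring.
rewrite cosD cos_mulr2n sin_mulr2n.
have := sin2cos2 x; set s := sin x; set c := cos x => Es.
by transitivity ((c ^+ 2 *+ 2 - 1) * c - 2 * c * s ^+ 2); [ring|rewrite Es; ring].
Qed.

Lemma cos_mul4 (R : realType) (x : R) :
  cos (4 * x) = 8 * cos x ^+ 4 - 8 * cos x ^+ 2 + 1.
Proof.
have -> : 4 * x = (x *+ 2) *+ 2 by ring.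
by rewrite !cos_mulr2n; ring.
Qed.

(** Tripling the angle gives [cos (pi / 2) = 0], so [4 c ^+ 3 = 3 c], and [c > 0] can be
    cancelled. *)
Lemma cos_pi6_sqr (R : realType) : cos (pi / 6 : R) ^+ 2 = 3 / 4.
Proof.
have c_gt0 : 0 < cos (pi / 6 : R).
  by apply: cos_gt0_pihalf; have := pi_gt0 R => ?; apply/andP; split; lra.
have := cos_mul3 (pi / 6 : R).
have -> : 3 * (pi / 6) = pi / 2 :> R by field.
rewrite cos_pihalf => E.
apply: (mulfI (lt0r_neq0 c_gt0)).
by lra.
Qed.

Lemma cospoly4E (R : realType) (a : 'I_5 -> R) (phi : R) :
  cospoly a phi = a ord0 + a (inord 1) * cos phi
    + a (inord 2) * (2 * cos phi ^+ 2 - 1)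
    + a (inord 3) * (4 * cos phi ^+ 3 - 3 * cos phi)
    + a (inord 4) * (8 * cos phi ^+ 4 - 8 * cos phi ^+ 2 + 1).
Proof.
have E (k : 'I_5) : k = inord k by apply: val_inj; rewrite /= inordK.
rewrite /cospoly !big_ord_recl big_ord0.
rewrite (E (lift ord0 ord0)) (E (lift ord0 (lift ord0 ord0))).
rewrite (E (lift ord0 (lift ord0 (lift ord0 ord0)))).
rewrite (E (lift ord0 (lift ord0 (lift ord0 (lift ord0 ord0))))) /=.
rewrite /bump /= !add1n !inordK // mul0r cos0 mul1r cos_mul3 cos_mul4.
have -> : 2 * phi = phi *+ 2 by ring.
by rewrite cos_mulr2n; ring.
Qed.

Lemma cospoly4_0 (R : realType) (a : 'I_5 -> R) :
  cospoly a 0 = a ord0 + a (inord 1) + a (inord 2) + a (inord 3) + a (inord 4).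
Proof. by rewrite cospoly4E cos0; ring. Qed.

(** Substituting [phi = acos x] makes nonnegativity algebraic, so that it can be tested at chosen
    values of the cosine. *)
Lemma Ccos4_ge0 (R : realType) (a : 'I_5 -> R) (x : R) :
  Ccos R 4 a -> -1 <= x <= 1 ->
  0 <= a ord0 + a (inord 1) * x + a (inord 2) * (2 * x ^+ 2 - 1)
    + a (inord 3) * (4 * x ^+ 3 - 3 * x)
    + a (inord 4) * (8 * x ^+ 4 - 8 * x ^+ 2 + 1).
Proof.
move=> [_ _ _ a_ge0] xI; have := a_ge0 (acos x).
by rewrite cospoly4E acosK ?in_itv.
Qed.

Lemma cospolyZ (R : realType) (n : nat) (c : R) (a : 'I_n.+1 -> R) (phi : R) :
  cospoly (fun k => c * a k) phi = c * cospoly a phi.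
Proof. by rewrite /cospoly mulr_sumr; apply: eq_bigr => k _; rewrite mulrA. Qed.

Lemma CcosZ (R : realType) (n : nat) (c : R) (a : 'I_n.+1 -> R) :
  0 < c -> Ccos R n a -> Ccos R n (fun k => c * a k).
Proof.
move=> c_gt0 [a_ge0 a0_gt0 a01 f_ge0]; split.
- by move=> k; apply: mulr_ge0 => //; exact: ltW.
- exact: mulr_gt0.
- by rewrite ltr_pM2l.
- by move=> phi; rewrite cospolyZ; apply: mulr_ge0 => //; exact: ltW.
Qed.

(** Numerator and denominator are both homogeneous of degree 1: each square root contributes
    [sqrt c], which is then squared. *)
Lemma vfunZ (R : realType) (n : nat) (c : R) (a : 'I_n.+1 -> R) :
  0 < c -> vfun (fun k => c * a k) = vfun a.
Proof.
move=> c_gt0; rewrite /vfun cospolyZ /Defs.coef0 /Defs.coef1 !sqrtrM ?ltW //.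
rewrite -!mulrBr exprMn sqr_sqrtr ?ltW // -mulf_div divff ?mul1r //.
exact: lt0r_neq0.
Qed.

Lemma vfun_coef0_1 (R : realType) (n : nat) (a : 'I_n.+1 -> R) :
  Defs.coef0 a = 1 ->
  vfun a = (cospoly a 0 - 1) / (Num.sqrt (Defs.coef1 a) - 1) ^+ 2.
Proof. by rewrite /vfun => ->; rewrite sqrtr1. Qed.

Lemma sqr_sqrtB1_gt0 (R : realType) (t : R) :
  1 < t -> 0 < (Num.sqrt t - 1) ^+ 2.
Proof.
move=> t_gt1; rewrite exprn_gt0 // subr_gt0 -(@sqrtr1 R) ltr_sqrt //.
exact: lt_trans t_gt1.
Qed.

Lemma chi_div_le (R : realType) (n : nat) (a : 'I_n.+1 -> R) :
  Ccos R n a -> Defs.coef0 a = 1 ->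
  (chi n (Defs.coef1 a) / ((Num.sqrt (Defs.coef1 a) - 1) ^+ 2)%:E
    <= (vfun a)%:E)%E.
Proof.
move=> aC a0; have r_gt0 : 0 < (Num.sqrt (Defs.coef1 a) - 1) ^+ 2.
  by apply: sqr_sqrtB1_gt0; case: aC => _ _; rewrite a0.
rewrite inver gt_eqF // lee_pdivrMr // -EFinM vfun_coef0_1 // divfK ?gt_eqF //.
by apply: ereal_inf_lbound; exists a.
Qed.

(** All competitors for [chi n t] share one positive denominator, so each quotient is a value of
    [vfun]. If there are none, [chi n t] is +oo and the bound is trivial. *)
Lemma Vinf_le_chi_div (R : realType) (n : nat) (t : R) :
  1 < t -> (Vinf R n <= chi n t / ((Num.sqrt t - 1) ^+ 2)%:E)%E.
Proof.
move=> t_gt1; have r_gt0 := sqr_sqrtB1_gt0 t_gt1.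
rewrite inver gt_eqF // lee_pdivlMr //.
apply: le_ereal_inf_tmp => _ [a [aC [a0 a1]] <-].
rewrite -lee_pdivlMr // -EFinM.
by apply: ereal_inf_lbound; exists a => //; rewrite vfun_coef0_1 ?a1.
Qed.

Lemma Ccos4_coef1_le (R : realType) (a : 'I_5 -> R) :
  Ccos R 4 a -> Defs.coef0 a = 1 -> Defs.coef1 a <= 2 * cos (pi / 6).
Proof.
rewrite /Defs.coef0 /Defs.coef1 => aC a0.
have c2 := cos_pi6_sqr R; set c := cos _ in c2 *.
have c_gt0 : 0 < c.
  by apply: cos_gt0_pihalf; have := pi_gt0 R => ?; apply/andP; split; lra.
have cI : -1 <= - c <= 1 by apply/andP; split; nra.
have := Ccos4_ge0 aC cI; have /(Ccos4_ge0 aC) : -1 <= (0 : R) <= 1.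
  by apply/andP; split; lra.
have -> : (- c) ^+ 2 = 3 / 4 by rewrite sqrrN.
have -> : (- c) ^+ 3 = - (3 / 4 * c) by rewrite -c2; ring.
have -> : (- c) ^+ 4 = (3 / 4) ^+ 2 by rewrite -c2; ring.
rewrite a0; set b1 := a _; set b2 := a _; set b3 := a _; set b4 := a _ => H0 Hc.
(* In [2 f(-c) + f(0)], with [f] read as a polynomial in the cosine, [b2], [b3] and [b4] cancel.
   This leaves [3 - 2 b1 c >= 0], that is [b1 c <= 3/2 = 2 c ^+ 2]. *)
by rewrite -(ler_pM2r c_gt0) -mulrA -expr2 c2; lra.
Qed.

Lemma Ccos4_vfun_ge36 (R : realType) (a : 'I_5 -> R) :
  Ccos R 4 a -> Defs.coef0 a = 1 -> Defs.coef1 a < 15597515%:R / 10 ^+ 7 ->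
  36 <= vfun a.
Proof.
move=> aC a0 a1_lt; have a1_gt1 : 1 < Defs.coef1 a by case: aC; rewrite a0.
rewrite vfun_coef0_1 // ler_pdivlMr ?sqr_sqrtB1_gt0 //.
(* At cosine -4/5 the factors of [a_2], [a_3], [a_4] are 7/25, 44/125 and -527/625; the multiplier
   125/44 cancels [a_3] exactly. *)
have lb : (144 * Defs.coef1 a - 125) / 44 <= cospoly a 0 - 1.
  have /(Ccos4_ge0 aC) : -1 <= (- (4 / 5) : R) <= 1.
    by apply/andP; split; lra.
  rewrite cospoly4_0; move: a0; rewrite /Defs.coef0 /Defs.coef1 => ->.
  case: aC => a_ge0 _ _ _.
  by have := a_ge0 (inord 2); have := a_ge0 (inord 3); have := a_ge0 (inord 4); lra.
apply: le_trans lb.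
have a1E : Num.sqrt (Defs.coef1 a) ^+ 2 = Defs.coef1 a by rewrite sqr_sqrtr; lra.
have s_ge0 : 0 <= Num.sqrt (Defs.coef1 a) := sqrtr_ge0 _.
set s := Num.sqrt _ in a1E s_ge0 *; rewrite -a1E in a1_lt a1_gt1 *.
have s_gt1 : 1 <= s by nra.
(* [1.249 ^+ 2 = 1.560001] just exceeds the cutoff. The goal amounts to
   [1440 s ^+ 2 - 3168 s + 1709 <= 0], a convex quadratic that is negative at both 1 and 1.249. *)
have s_lt : s <= 1249 / 1000 by nra.
by nra.
Qed.

(** Cosine coefficients of [((1 + c) * (1 + 2 * c) / 3) ^+ 2] with [c = cos phi]. *)
Definition trial_poly (R : realType) (k : 'I_5) : R :=
  nth 0 [:: 1; 5 / 3; 17 / 18; 1 / 3; 1 / 18] k.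

Lemma trial_poly_Ccos (R : realType) : Ccos R 4 (@trial_poly R).
Proof.
split.
- by case=> [[|[|[|[|[|k]]]]] lt_k] //; rewrite /trial_poly /=; lra.
- by rewrite /Defs.coef0 /trial_poly /=; lra.
- by rewrite /Defs.coef0 /Defs.coef1 /trial_poly inordK //=; lra.
- move=> phi; rewrite cospoly4E /trial_poly !inordK //=.
  set c := cos phi.
  have -> : 1 + 5 / 3 * c + 17 / 18 * (2 * c ^+ 2 - 1)
      + 1 / 3 * (4 * c ^+ 3 - 3 * c) + 1 / 18 * (8 * c ^+ 4 - 8 * c ^+ 2 + 1)
    = ((1 + c) * (1 + 2 * c) / 3) ^+ 2 by field.
  exact: sqr_ge0.
Qed.

Lemma trial_poly_coef1 (R : realType) : Defs.coef1 (@trial_poly R) = 5 / 3.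
Proof. by rewrite /Defs.coef1 /trial_poly inordK. Qed.

Lemma trial_poly_vfun (R : realType) : vfun (@trial_poly R) <= 36.
Proof.
rewrite vfun_coef0_1 // trial_poly_coef1 ler_pdivrMr; last first.
  by apply: sqr_sqrtB1_gt0; lra.
rewrite cospoly4_0 /trial_poly !inordK //=.
have sE : Num.sqrt (5 / 3) ^+ 2 = 5 / 3 :> R by rewrite sqr_sqrtr; lra.
have s_ge0 := sqrtr_ge0 (5 / 3 : R).
set s := Num.sqrt _ in sE s_ge0 *.
(* Here [f(0) - 1 = 3], and [3 <= 36 (s - 1) ^+ 2] with [s ^+ 2 = 5/3] says exactly [s <= 31/24];
   indeed 5/3 = 960/576 < 961/576. *)
have : s <= 31 / 24 by nra.
by nra.
Qed.

Theorem theorem4p3 (R : realType) :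
  Vinf R 4 =
  ereal_inf [set (chi 4 t / ((Num.sqrt t - 1) ^+ 2)%:E)%E |
             t in [set t : R | 15597515%:R / 10 ^+ 7 <= t <= 2 * cos (pi / 6)]].
Proof.
apply/eqP; rewrite eq_le; apply/andP; split.
  apply: le_ereal_inf_tmp => _ [t /andP[t_ge _] <-].
  by apply: Vinf_le_chi_div; lra.
set T := [set _ | _ in _].
have large (a : 'I_5 -> R) : Ccos R 4 a -> Defs.coef0 a = 1 ->
    15597515%:R / 10 ^+ 7 <= Defs.coef1 a -> (ereal_inf T <= (vfun a)%:E)%E.
  move=> aC a0 a1_ge; apply: le_trans (chi_div_le aC a0).
  apply: ereal_inf_lbound; exists (Defs.coef1 a) => //=.
  by rewrite a1_ge Ccos4_coef1_le.
apply: le_ereal_inf_tmp => _ [a aC <-].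
have a0_gt0 : 0 < Defs.coef0 a by case: aC.
have cV_gt0 : 0 < (Defs.coef0 a)^-1 by rewrite invr_gt0.
rewrite -(vfunZ a cV_gt0); set b := fun k => _.
have bC : Ccos R 4 b by apply: CcosZ.
have b0 : Defs.coef0 b = 1 by rewrite {1}/Defs.coef0 /b mulVf ?gt_eqF.
have [/(large _ bC b0) // | b1_lt] := lerP (15597515%:R / 10 ^+ 7) (Defs.coef1 b).
(* For [a_1] below the cutoff, 36 separates [b] from the trial polynomial, whose [a_1 = 5/3] lies in
   the range covered by [large]. *)
apply: le_trans (_ : (vfun (@trial_poly R))%:E <= _)%E.
  by apply: large; [exact: trial_poly_Ccos | | rewrite trial_poly_coef1; lra].
by rewrite lee_fin (le_trans (trial_poly_vfun R)) ?Ccos4_vfun_ge36.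
Qed.
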